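(* There is an algorithm that, given a finite family $\mathcal B$ of finite sets, determines in time $O(n^2m)$ whether $\mathcal B$ is the base of a $\cup$-closed well-graded family, where $n$ is the number of sets in $\mathcal B$ and $m$ is the sum of the cardinalities of the sets in $\mathcal B$.
   Context: All sets and families are finite. For finite sets $P,Q$ let $d(P,Q)=|P\bigtriangleup Q|$. A tight path in a family $\mathcal F$ between distinct $P,Q\in\mathcal F$ is a sequence $P_0=P,P_1,\ldots,P_n=Q$ of members of $\mathcal F$ with $d(P,Q)=n$ and $d(P_i,P_{i+1})=1$ for $0\le i\le n-1$. The family $\mathcal F$ is well-graded if there is a tight path in $\mathcal F$ between any two of its distinct sets. $\mathcal F$ is $\cup$-closed if $\cup\mathcal G\in\mathcal F$ for every nonempty $\mathcal G\subseteq\mathcal F$. The span of a family $\mathcal G$ is the family of all unions of nonempty subfamilies of $\mathcal G$ (so $\varnothing$ is in the span only if $\varnothing\in\mathcal G$). A base of a $\cup$-closed family $\mathcal F$ is a subfamily of $\mathcal F$ whose span is $\mathcal F$ and which is minimal under inclusion with this property. Model of computation: standard random-access machine, with simple arithmetic steps and memory accesses in constant time. Each set element is an object of constant storage with which further information can be associated (e.g. elements are integers $0,1,2,\ldots$ usable as array indices); a set is given as a list of its elements and a family of sets as a list of such lists. Running times are worst case. *)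

(* Defs.v *)
From mathcomp Require Import all_boot.
From mathcomp Require Import finmap.

Set Implicit Arguments.
Unset Strict Implicit.
Unset Printing Implicit Defensive.

Local Open Scope fset_scope.
Local Open Scope nat_scope.

Section Families.
Variable K : choiceType.
Implicit Types (P Q : {fset K}) (F G B : {fset {fset K}}).

Definition fdist P Q : nat := #|` (P `\` Q) `|` (Q `\` P)|.

(* The sequence P :: p = P_0, P_1, ..., P_n, where n = size p. *)
Definition tight_path F P Q (p : seq {fset K}) : Prop :=
  [/\ {subset P :: p <= F},
      last P p = Q,
      size p = fdist P Q &
      path (fun X Y => fdist X Y == 1) P p].

Definition well_graded F : Prop :=
  forall P Q, P \in F -> Q \in F -> P <> Q -> exists p, tight_path F P Q p.

Definition union_closed F : Prop :=
  forall G, G `<=` F -> G != fset0 -> fcover G \in F.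

(* Only nonempty subfamilies are used: fset0 \in span G iff fset0 \in G. *)
Definition span G : {fset {fset K}} :=
  [fset fcover H | H in fpowerset G & H != fset0].

Definition is_base B F : Prop :=
  [/\ B `<=` F,
      span B = F &
      forall B', B' `<=` B -> span B' = F -> B' = B].

End Families.

(* A unit-cost random-access machine: a program is a finite list of           *)
(* instructions acting on registers and on an array of memory cells, all of   *)
(* them holding natural numbers.  Arithmetic is limited to addition and       *)
(* truncated subtraction; multiplication is left out on purpose, since at     *)
(* unit cost it would allow enormous numbers to be built in few steps.        *)
Inductive instr : Type :=
| Const of nat & nat        (* Const r k : r := k             *)
| Move of nat & nat         (* Move r s  : r := s             *)
| Add of nat & nat & nat    (* Add r s t : r := s + t         *)
| Sub of nat & nat & nat    (* Sub r s t : r := s - t         *)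
| Read of nat & nat         (* Read r s  : r := mem[s]        *)
| Write of nat & nat        (* Write r s : mem[r] := s        *)
| Jump of nat               (* Jump l    : go to l            *)
| JumpZero of nat & nat     (* JumpZero r l : if r = 0 go to l *)
| Halt.

Definition program := seq instr.

Record config : Type := Config {
  pc : nat;
  reg : nat -> nat;
  mem : nat -> nat
}.

Definition upd (f : nat -> nat) (a v : nat) : nat -> nat :=
  fun x => if x == a then v else f x.

(* Running past the last instruction is halting. *)
Definition fetch (p : program) (c : config) : instr := nth Halt p (pc c).

Definition step (p : program) (c : config) : config :=
  let: Config i r m := c in
  match fetch p c with
  | Const x k => Config i.+1 (upd r x k) m
  | Move x y => Config i.+1 (upd r x (r y)) m
  | Add x y z => Config i.+1 (upd r x (r y + r z)) m
  | Sub x y z => Config i.+1 (upd r x (r y - r z)) m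
  | Read x y => Config i.+1 (upd r x (m (r y))) m
  | Write x y => Config i.+1 r (upd m (r x) (r y))
  | Jump l => Config l r m
  | JumpZero x l => Config (if r x == 0 then l else i.+1) r m
  | Halt => c
  end.

Definition halted (p : program) (c : config) : Prop :=
  if fetch p c is Halt then True else False.

Definition initial (input : seq nat) : config :=
  Config 0 (fun _ => 0) (fun a => nth 0 input a).

(* p halts on input after at most t steps, leaving its answer in register 0. *)
Definition outputs_within (p : program) (input : seq nat) (t : nat) (b : bool)
    : Prop :=
  let c := iter t (step p) (initial input) in
  halted p c /\ reg c 0 = nat_of_bool b.

(* L lists the members of B, in any order and without repetition, each given  *)
(* as a list of its elements, in any order and without repetition.            *)
Definition lists_family (L : seq (seq nat)) (B : {fset {fset nat}}) : Prop :=
  all uniq L /\ perm_eq [seq [fset x in s] | s <- L] (enum_fset B).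

(* Memory layout: the number of lists, then each list preceded by its length. *)
Definition encode (L : seq (seq nat)) : seq nat :=
  size L :: flatten [seq size s :: s | s <- L].

(* Main.v *)
Require Import Defs.
From mathcomp Require Import all_boot.
From mathcomp Require Import finmap zify ring.
From Stdlib Require Import FunctionalExtensionality.

(* The only candidate is F = span B, which is always union-closed.  B is its  *)
(* base iff no nonempty Q in B is the union of the members of B properly      *)
(* contained in Q, i.e. iff some element of Q is not "covered" from P = {},   *)
(* where S in B covers x from P inside Q if x in S and S \ P is a proper       *)
(* subset of Q \ P.  The span is well-graded iff, for all P, Q in B, at most  *)
(* one element of Q \ P is not covered: given two such elements x and y, the  *)
(* first set of a tight path from P to Q that contains x or y would contain a *)
(* member of B covering it.  Conversely, if X and Y are in the span and Y is  *)
(* not included in X, fix P in B with P included in X and take Q in B inside  *)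
(* X u Y, not inside X, with Q \ P smallest: then Q \ X is a singleton, which *)
(* gives one step of a tight path.                                            *)
(* For fixed P and Q the covered elements are found by two scans of every S,  *)
(* with marks stored in an array indexed by the elements, in time O(n + m),   *)
(* and n <= m + 1 because the sets are distinct.                              *)

(** [base_well_gradedP] reduces the question to two conditions on the members of [B] alone,
    [irredundant] and [accessible]; [well_graded_accessible] and [accessible_step] carry the
    equivalence with well-gradedness. Both conditions bound the number of uncovered elements of Q \
    P: at least one when P is empty and Q is not, at most one for every pair. The program adds up
    all violations ([failures]) and tests whether the total is 0. Each of the n^2 pairs costs O(n +
    m), since only cells of listed elements are visited and the marks that were set are cleared
    again. Correctness and time are proved together by Hoare triples with step bounds:
    [hoare_foreach] and [hoare_for_lists] treat the two kinds of loop, [hoare_base_test] the whole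
    program, and [base_test_cost] absorbs the n^3 term by n <= m + 1. *)

Set Implicit Arguments.
Unset Strict Implicit.
Unset Printing Implicit Defensive.

(** * Unions of members of a family *)

Section Characterization.
Local Open Scope fset_scope.
Local Open Scope nat_scope.

Variable K : choiceType.
Implicit Types (P Q S X Y Z : {fset K}) (F G B : {fset {fset K}}).

Lemma fcoverP F x : reflect (exists2 S, S \in F & x \in S) (x \in fcover F).
Proof.
apply: (iffP (bigfcupP _ _ _ _)) => [[S /andP[SF _] xS]|[S SF xS]]; exists S => //.
by rewrite SF.
Qed.

Lemma spanP B X :
  reflect ((exists2 S, S \in B & S `<=` X) /\
           (forall x, x \in X -> exists S, [/\ S \in B, S `<=` X & x \in S]))
          (X \in span B).
Proof.
apply: (iffP (imfsetP _ _ _ _)) => /= [[G]|[[S SB SX] H]].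
  rewrite inE fpowersetE => /andP[/fsubsetP GB /fset0Pn [S SG]] ->.
  have sub T : T \in G -> T `<=` fcover G.
    by move=> TG; apply/fsubsetP => x xT; apply/fcoverP; exists T.
  split=> [|x /fcoverP [T TG xT]]; first by exists S; [apply: GB | apply: sub].
  by exists T; split=> //; [apply: GB | apply: sub].
exists [fset T in B | T `<=` X].
  rewrite inE fpowersetE; apply/andP; split.
    by apply/fsubsetP => T; rewrite !inE => /andP[].
  by apply/fset0Pn; exists S; rewrite !inE SB.
apply/fsetP => x; apply/idP/fcoverP => [/H [T [TB TX xT]]|[T]].
  by exists T => //; rewrite !inE TB.
by rewrite !inE => /andP[_ /fsubsetP TX]; apply: TX.
Qed.

Lemma sub_span B : B `<=` span B.
Proof.
apply/fsubsetP => X XB; apply/spanP; split=> [|x xX]; first by exists X.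
by exists X.
Qed.

Lemma span_union_closed B : union_closed (span B).
Proof.
move=> G /fsubsetP GB /fset0Pn [X XG].
have sub T Y : Y \in G -> T `<=` Y -> T `<=` fcover G.
  move=> YG /fsubsetP TY; apply/fsubsetP => x /TY xY.
  by apply/fcoverP; exists Y.
apply/spanP; split.
  have /spanP[[S SB SX] _] := GB _ XG.
  by exists S => //; apply: sub SX.
move=> x /fcoverP [Y YG xY].
have /spanP[_ /(_ x xY) [S [SB SY xS]]] := GB _ YG.
by exists S; split=> //; apply: sub SY.
Qed.

Lemma span_fsetU B X Y : X \in span B -> Y \in span B -> X `|` Y \in span B.
Proof.
move=> XB YB; have -> : X `|` Y = fcover [fset X; Y].
  apply/fsetP => x; rewrite inE; apply/orP/fcoverP => [[]|[Z]].
  - by exists X; rewrite // !inE eqxx.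
  - by exists Y; rewrite // !inE eqxx orbT.
  - by rewrite !inE => /orP[] /eqP ->; [left|right].
apply: span_union_closed.
  by apply/fsubsetP => Z; rewrite !inE => /orP[] /eqP ->.
by apply/fset0Pn; exists X; rewrite !inE eqxx.
Qed.

Definition covered B P Q x : Prop :=
  exists S, [/\ S \in B, x \in S & (S `\` P) `<` (Q `\` P)].

Definition irredundant B : Prop :=
  forall Q, Q \in B -> Q != fset0 -> exists2 x, x \in Q & ~ covered B fset0 Q x.

Definition accessible B : Prop :=
  forall P Q x y, P \in B -> Q \in B -> x \in Q `\` P -> y \in Q `\` P ->
    x != y -> covered B P Q x \/ covered B P Q y.

(** The element [z] is counted in both distances on the right and not on the left. *)
Lemma fdist_ltn P Q Z z :
  z \in Z -> z \notin P -> z \notin Q -> fdist P Q < fdist P Z + fdist Z Q.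
Proof.
move=> zZ zP zQ; rewrite /fdist.
set A := _ `|` _; set C := (P `\` Z) `|` _; set D := (Z `\` Q) `|` _.
have zC : z \in C by rewrite !inE zZ zP orbT.
have zD : z \in D by rewrite !inE zZ zQ.
have sub : A `<=` (C `\ z) `|` (D `\ z).
  apply/fsubsetP => x; rewrite !inE; case: eqP => [->|_].
    by rewrite (negPf zP) (negPf zQ).
  by case: (x \in P); case: (x \in Q); case: (x \in Z).
have := fsubset_leq_card sub; have := cardfsUI (C `\ z) (D `\ z).
by have := cardfsD1 z C; have := cardfsD1 z D; rewrite zC zD; lia.
Qed.

Lemma fdist_triangle P Q Z : fdist P Q <= fdist P Z + fdist Z Q.
Proof.
rewrite /fdist -cardfsUI; apply: leq_trans (leq_addr _ _).
apply: fsubset_leq_card; apply/fsubsetP => x; rewrite !inE.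
by case: (x \in P); case: (x \in Q); case: (x \in Z).
Qed.

Lemma path_fdist X p : path (fun Y Z => fdist Y Z == 1) X p -> fdist X (last X p) <= size p.
Proof.
elim: p X => [|Y p IH] X /=; first by rewrite /fdist fsetDv fsetU0 cardfs0.
case/andP=> /eqP d1 /IH; have := fdist_triangle X (last Y p) Y; lia.
Qed.

Lemma tight_path_sub F P Q p Z : tight_path F P Q p -> Z \in p -> Z `<=` P `|` Q.
Proof.
move=> [_ + + +] /splitPr def; case: def => p1 p2.
rewrite last_cat /= cat_path size_cat /= => <- sz /and3P[pp1 /eqP d1 pp2].
apply/fsubsetP => z zZ; rewrite inE; apply/negPn/negP; rewrite negb_or => /andP[zP zQ].
have := fdist_ltn zZ zP zQ; have := path_fdist pp1; have := path_fdist pp2.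
by have := fdist_triangle P Z (last P p1); lia.
Qed.

(** One step changes a single element, so [x] and [y] cannot enter together. *)
Lemma path_split X p x y :
  path (fun Y Z => fdist Y Z == 1) X p -> x != y ->
  x \notin X -> y \notin X -> x \in last X p ->
  exists2 Z, Z \in p & (x \in Z) != (y \in Z).
Proof.
move=> pp nxy; elim: p X pp => [|Y p IH] X /=; first by move=> _ /negPf ->.
case/andP=> d1 pp xX yX xl.
case: (boolP ((x \in Y) == (y \in Y))) => [/eqP exy|ne]; last first.
  by exists Y; rewrite ?inE ?eqxx.
case: (boolP (x \in Y)) => xY; last first.
  have [|Z Zp] := IH _ pp xY _ xl; first by rewrite -exy.
  by exists Z; rewrite ?inE ?Zp ?orbT.
have yY : y \in Y by rewrite -exy.
have sub : [fset x; y] `<=` (X `\` Y) `|` (Y `\` X).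
  by apply/fsubsetP => z; rewrite !inE => /orP[] /eqP ->; rewrite ?xY ?xX ?yX ?yY.
have := fsubset_leq_card sub; rewrite -/(fdist X Y) (eqP d1).
by rewrite cardfs2 nxy.
Qed.

Lemma well_graded_accessible B : well_graded (span B) -> accessible B.
Proof.
move=> wg P Q x y PB QB.
rewrite !in_fsetD => /andP[xP xQ] /andP[yP yQ] nxy.
have PF := fsubsetP (sub_span B) _ PB.
have QF := fsubsetP (sub_span B) _ QB.
have [|p tp] := wg P Q PF QF; first by move=> e; rewrite e xQ in xP.
have [pF lst _ pth] := tp.
have [|Z Zp] := path_split pth nxy xP yP; first by rewrite lst.
have ZF : Z \in span B by apply: pF; rewrite inE Zp orbT.
have /fsubsetP ZPQ := tight_path_sub tp Zp.
(* A member of [B] inside [Z] that contains [u] misses [v], so outside [P] it is a proper part of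
   [Q]. *)
have cov u v : u \in Z -> v \in Q -> v \notin P -> v \notin Z -> covered B P Q u.
  move=> uZ vQ vP vZ; have /spanP[_ /(_ u uZ) [S [SB /fsubsetP SZ uS]]] := ZF.
  exists S; split=> //; rewrite fproperE; apply/andP; split.
    apply/fsubsetP => w; rewrite !in_fsetD => /andP[wP /SZ/ZPQ].
    by rewrite in_fsetU (negPf wP).
  apply/fsubsetPn; exists v; first by rewrite !inE vP vQ.
  by rewrite !inE vP; apply: contra vZ => /SZ.
case xZ: (x \in Z); case yZ: (y \in Z) => // _; [left|right].
  by apply: (cov x y) => //; rewrite yZ.
by apply: (cov y x) => //; rewrite xZ.
Qed.

(** * Bases and irredundancy *)

Lemma is_base_irredundant B F : is_base B F -> irredundant B.
Proof.
move=> [_ spB min] Q QB /fset0Pn [x0 x0Q].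
case: (boolP [exists x : Q, ~~ [exists S : B, (val x \in val S) && (val S `<` Q)]]).
  case/existsP => x /existsPn H; exists (val x); first exact: valP.
  move=> [S [SB xS]]; rewrite !fsetD0 => SQ.
  by have := H [` SB]; rewrite /= xS SQ.
move/existsPn => H.
have cov x : x \in Q -> exists S, [/\ S \in B `\ Q, S `<=` Q & x \in S].
  move=> xQ; have /negPn/existsP [S /andP[/= xS SQ]] := H [` xQ].
  exists (val S); split=> //; last exact: fproper_sub.
  by rewrite !inE fsvalP andbT; apply: contraTneq SQ => ->; rewrite fproperEneq eqxx.
have : B `\ Q = B; last by move/fsetP/(_ Q); rewrite !inE eqxx QB.
apply: min; first exact: fsubD1set.
rewrite -spB; apply/fsetP => X; apply/spanP/spanP => -[[S SB SX] HX].
  split=> [|x /HX [T [TB TX xT]]].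
    by exists S => //; move: SB; rewrite !inE => /andP[].
  by exists T; split=> //; move: TB; rewrite !inE => /andP[].
have red T x : T \in B -> T `<=` X -> x \in T ->
    exists U, [/\ U \in B `\ Q, U `<=` X & x \in U].
  move=> TB TX xT; have [eTQ|nTQ] := eqVneq T Q; last first.
    by exists T; split; rewrite // !inE nTQ.
  rewrite eTQ in xT TX; have [U [UB UQ xU]] := cov _ xT.
  by exists U; split=> //; apply: fsubset_trans TX.
split=> [|x /HX [T [TB TX xT]]]; last exact: red TX xT.
have [eSQ|nSQ] := eqVneq S Q; last by exists S; rewrite // !inE nSQ.
(* The point [x0] of [Q] supplies the member that a nonempty subfamily needs. *)
rewrite eSQ in SX; have [U [UB UX xU]] := red _ _ QB SX x0Q.
by exists U.
Qed.

(** When [Q] is rebuilt from a subfamily, the member used for an uncovered element of [Q] can only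
    be [Q] itself. *)
Lemma irredundant_is_base B : irredundant B -> is_base B (span B).
Proof.
move=> irr; split=> //; first exact: sub_span.
move=> B' /fsubsetP sub eqs; apply/eqP; rewrite eqEfsubset.
apply/andP; split; apply/fsubsetP => // Q QB.
have /spanP [[S SB SQ] H] : Q \in span B' by rewrite eqs (fsubsetP (sub_span B)).
have [Q0|Qn0] := eqVneq Q fset0; first by move: SQ; rewrite Q0 fsubset0 => /eqP <-.
have [x xQ] := irr _ QB Qn0; have [U [UB UQ xU]] := H _ xQ.
have [<- //|nUQ] := eqVneq U Q.
by case; exists U; split; rewrite ?sub // !fsetD0 fproperEneq nUQ.
Qed.

(** * From accessibility to well-gradedness *)

Lemma accessible_step B X Y :
  accessible B -> X \in span B -> Y \in span B -> ~~ (Y `<=` X) ->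
  exists z, [/\ z \in Y, z \notin X & z |` X \in span B].
Proof.
move=> acc XF YF /fsubsetPn [y yY yX].
have /spanP[[P PB PX] _] := XF; have /fsubsetP PX' := PX.
have /spanP[_ /(_ y yY) [Q0 [Q0B Q0Y yQ0]]] := YF.
have : exists k, exists2 Q, [&& Q \in B, Q `<=` X `|` Y & ~~ (Q `<=` X)] &
   #|` Q `\` P| < k.
  exists #|` Q0 `\` P|.+1, Q0 => //; rewrite Q0B /=; apply/andP; split.
    by apply: fsubset_trans Q0Y _; apply: fsubsetUr.
  by apply/fsubsetPn; exists y.
case=> k [Q]; elim: k Q => // k IH Q /and3P[QB QXY QX] ltk.
have /fsubsetPn [z zQ zX] := QX.
have zY : z \in Y by have := fsubsetP QXY _ zQ; rewrite inE (negPf zX).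
have [sub|/fsubsetPn [u uQ uzX]] := boolP (Q `<=` z |` X).
  exists z; split=> //; have -> : z |` X = X `|` Q.
    apply/eqP; rewrite eqEfsubset !fsubUset fsub1set !inE zQ orbT fsubsetUl /=.
    by rewrite sub fsubsetUr.
  by apply: span_fsetU => //; apply: (fsubsetP (sub_span B)).
move: uzX; rewrite !inE negb_or => /andP[nuz uX].
(* A set covering [u] or [z] is again inside the union of [X] and [Y] and not inside [X], and has
   fewer elements outside [P]: the descent continues with it. *)
have next w : w \notin X -> covered B P Q w ->
    exists z, [/\ z \in Y, z \notin X & z |` X \in span B].
  move=> wX [S [SB wS SQ]]; apply: (IH S).
    rewrite SB /=; apply/andP; split; last by apply/fsubsetPn; exists w.
    apply/fsubsetP => v vS; have [vP|vP] := boolP (v \in P).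
      by rewrite inE PX'.
    apply: (fsubsetP QXY); have /fsubsetP/(_ v) := fproper_sub SQ.
    by rewrite !inE vP vS => /(_ isT).
  exact: leq_trans (fproper_ltn_card SQ) ltk.
have PD w : w \in Q -> w \notin X -> w \in Q `\` P.
  by move=> wQ wX; rewrite inE wQ andbT; apply: contra wX => /PX'.
by case: (acc P Q u z PB QB (PD _ uQ uX) (PD _ zQ zX) nuz); apply: next.
Qed.

Lemma fdist_add X Y z : z \in Y -> z \notin X ->
  fdist X (z |` X) = 1 /\ fdist X Y = (fdist (z |` X) Y).+1.
Proof.
move=> zY zX; rewrite /fdist; split.
  have -> : (X `\` (z |` X)) `|` ((z |` X) `\` X) = [fset z].
    apply/fsetP => x; rewrite !inE; case: eqP => [->|_]; first by rewrite zX.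
    by case: (x \in X).
  exact: cardfs1.
rewrite (cardfsD1 z) !inE zX zY /= add1n; congr (#|` _|.+1).
apply/fsetP => x; rewrite !inE; case: eqP => [->|_] //=; by rewrite zY.
Qed.

Lemma fdistC X Y : fdist X Y = fdist Y X.
Proof. by rewrite /fdist fsetUC. Qed.

(** Induction on the distance: the path is built by enlarging [P] towards [Q], or, once [Q] is
    inside [P], from the other end by enlarging [Q] towards [P]. *)
Lemma accessible_well_graded B : accessible B -> well_graded (span B).
Proof.
move=> acc P Q PF QF _.
have [k] := ubnP (fdist P Q); elim: k P Q PF QF => // k IH P Q PF QF ltk.
have [QP|QP] := boolP (Q `<=` P); last first.
  have [z [zQ zP zF]] := accessible_step acc PF QF QP.
  have [d1 dS] := fdist_add zQ zP.
  have [|p [pF lst sz pth]] := IH _ _ zF QF; first by rewrite -ltnS -dS.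
  exists (z |` P :: p); split=> /=.
  - by move=> X; rewrite inE => /predU1P [-> //|/pF].
  - by [].
  - by rewrite sz dS.
  - by rewrite d1.
have [PQ|PQ] := boolP (P `<=` Q).
  have -> : P = Q by apply/eqP; rewrite eqEfsubset PQ.
  exists [::]; split=> //.
    by move=> X; rewrite inE => /eqP ->.
  by rewrite /fdist fsetDv fsetU0 cardfs0.
have [z [zP zQ zF]] := accessible_step acc QF PF PQ.
have [d1 dS] := fdist_add zP zQ.
have [|p [pF lst sz pth]] := IH _ _ PF zF.
  by rewrite fdistC -ltnS -dS fdistC.
exists (rcons p Q); split=> /=.
- by move=> X; rewrite -rcons_cons mem_rcons inE => /predU1P [-> //|/pF].
- by rewrite last_rcons.
- by rewrite size_rcons sz fdistC -dS fdistC.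
- by rewrite rcons_path pth lst fdistC d1.
Qed.

Lemma base_well_gradedP B :
  (exists F, [/\ union_closed F, well_graded F & is_base B F]) <->
  irredundant B /\ accessible B.
Proof.
split=> [[F [_ wg bs]]|[irr acc]].
  split; first exact: is_base_irredundant bs.
  by apply: well_graded_accessible; case: bs => _ ->.
exists (span B); split; first exact: span_union_closed.
  exact: accessible_well_graded.
exact: irredundant_is_base.
Qed.

End Characterization.

(** * Structured programs and their running time *)

Inductive cmd : Type :=
| Block of seq instr
| Seq of cmd & cmd
| While of nat & cmd.

(* Jump targets are absolute, hence the address l of the first instruction. *)
Fixpoint code (l : nat) (c : cmd) : seq instr :=
  match c with
  | Block b => b
  | Seq c1 c2 => let p := code l c1 in p ++ code (l + size p) c2
  | While r c1 =>
      let p := code l.+1 c1 in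
      JumpZero r (l + size p).+2 :: p ++ [:: Jump l]
  end.

(** Registers form a finite list read with default 0, so that blocks of instructions can be executed
    by simplification. *)
Definition state : Type := seq nat * (nat -> nat).

Definition conf (l : nat) (s : state) : config := Config l (nth 0 s.1) s.2.

Definition straight (i : instr) : bool :=
  match i with Jump _ | JumpZero _ _ | Halt => false | _ => true end.

Definition exec (s : state) (i : instr) : state :=
  let: (e, m) := s in
  let r := nth 0 e in
  let set x v := (set_nth 0 e x v, m) in
  match i with
  | Const x k => set x k
  | Move x y => set x (r y)
  | Add x y z => set x (r y + r z)
  | Defs.Sub x y z => set x (r y - r z)
  | Read x y => set x (m (r y))
  | Write x y => (e, upd m (r x) (r y))
  | _ => s
  end.

Lemma step_exec p l s :
  straight (nth Halt p l) -> step p (conf l s) = conf l.+1 (exec s (nth Halt p l)).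
Proof.
have upd_nth (e : seq nat) x v : upd (nth 0 e) x v = nth 0 (set_nth 0 e x v).
  by apply: functional_extensionality => y; rewrite nth_set_nth.
case: s => e m; rewrite /conf /step /= /fetch /=.
by case: (nth Halt p l) => //= *; rewrite upd_nth.
Qed.

(** Quantifying over the surrounding code makes runs composable although jump targets are
    absolute. *)
Definition runs (c : cmd) (s s' : state) (t : nat) : Prop :=
  forall pre post,
    let b := code (size pre) c in
    iter t (step (pre ++ b ++ post)) (conf (size pre) s)
    = conf (size pre + size b) s'.

Definition hoare (P : state -> Prop) (c : cmd) (Q : state -> Prop) (T : nat) : Prop :=
  forall s, P s -> exists s' t, [/\ runs c s s' t, t <= T & Q s'].

Lemma hoare_conseq P Q c T (P' Q' : state -> Prop) T' :
  hoare P' c Q' T' -> (forall s, P s -> P' s) -> (forall s, Q' s -> Q s) ->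
  T' <= T -> hoare P c Q T.
Proof.
move=> H HP HQ HT s /HP/H [s' [t [ht ltT /HQ q]]].
by exists s', t; split=> //; apply: leq_trans HT.
Qed.

Lemma hoare_cost P Q c T T' : hoare P c Q T' -> T' <= T -> hoare P c Q T.
Proof. by move=> H; apply: (hoare_conseq H). Qed.

Lemma runs_block b s : all straight b -> runs (Block b) s (foldl exec s b) (size b).
Proof.
move=> sb pre post /=.
elim: b pre s sb => [|i b IH] pre s /=; first by rewrite addn0.
case/andP=> si sb.
rewrite -iterS iterSr step_exec nth_cat ltnn subnn //=.
rewrite -cat1s catA -[(size pre).+1]addn1 -[1]/(size [:: i]) -size_cat.
by rewrite IH // size_cat /= addn1 addSnnS.
Qed.

Lemma hoare_block (P Q : state -> Prop) b :
  all straight b -> (forall s, P s -> Q (foldl exec s b)) ->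
  hoare P (Block b) Q (size b).
Proof.
move=> sb H s /H Qs; exists (foldl exec s b), (size b).
by split=> //; apply: runs_block.
Qed.

Lemma hoare_seq P R Q c1 c2 T1 T2 :
  hoare P c1 R T1 -> hoare R c2 Q T2 -> hoare P (Seq c1 c2) Q (T1 + T2).
Proof.
move=> H1 H2 s /H1 [s1 [t1 [r1 l1 /H2 [s2 [t2 [r2 l2 q]]]]]].
exists s2, (t2 + t1); split=> //; last by rewrite addnC leq_add.
move=> pre post /=; rewrite iterD.
set b1 := code _ c1; set b2 := code _ c2.
rewrite -[(b1 ++ b2) ++ post]catA; have := r1 pre (b2 ++ post); rewrite /= -/b1 => ->.
have := r2 (pre ++ b1) post; rewrite /= size_cat -/b2 -!catA => ->.
by rewrite size_cat addnA.
Qed.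

(* The loop variable register holds the number of items still to be treated. *)
Lemma hoare_while (A : Type) (I : seq A -> state -> Prop) r c T (xs : seq A) :
  (forall ys s, I ys s -> nth 0 s.1 r = size ys) ->
  (forall y ys, hoare (I (y :: ys)) c (I ys) (T y)) ->
  hoare (I xs) (While r c) (I [::]) (\sum_(x <- xs) (T x + 2) + 1).
Proof.
move=> Ir H; elim: xs => [|x xs IH] s Is.
  exists s, 1; split=> // [|]; last exact: leq_addl.
  move=> pre post /=; rewrite /fetch /= nth_cat ltnn subnn /= (Ir _ _ Is) /=.
  by rewrite size_cat /= addnS addn1 !addnS.
have [s1 [t1 [r1 l1 I1]]] := H _ _ _ Is.
have [s2 [t2 [r2 l2 I2]]] := IH _ I1.
(* One step for the test, [t1] for the body, one for the jump back, [t2] for the remaining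
   rounds. *)
exists s2, (t2 + (t1 + 1).+1); split=> //; last by rewrite big_cons; lia.
move=> pre post /=; rewrite -[RHS](r2 pre post) /= iterD; congr iter.
rewrite iterS iterD /= /fetch /= nth_cat ltnn subnn /= (Ir _ _ Is) /=.
set b := code _ c; set j := JumpZero _ _.
have := r1 (pre ++ [:: j]) (Jump (size pre) :: post).
rewrite /= !size_cat /= addn1 -/b -!catA /= -[conf _ s]/(Config _ _ _) => ->.
rewrite /conf /step /fetch /= nth_cat ifN; last by lia.
have -> : (size pre).+1 + size b - size pre = (size b).+1 by lia.
by rewrite /= nth_cat ltnn subnn.
Qed.

(** * The program *)

(* Use of the registers:                                                      *)
(*   0 address   1 value     2 temporary   3 list pointer   4 list counter    *)
(*   5, 6 accumulators       7 flag, then result          8 |Q \ P|           *)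
(*   9, 10 / 11, 12 / 13, 14 pointer and counter of the loops on S / P / Q    *)
(*   15 number of failures   16 address of the marks   17, 18 constants 1, 2  *)
Definition foreach_body (body : seq instr) : seq instr :=
  [:: Add 3 3 17; Read 1 3; Add 0 16 1; Read 1 0] ++ body ++
  [:: Write 0 1; Defs.Sub 4 4 17].

Definition foreach (i : nat) (body : seq instr) : cmd :=
  Seq (Block [:: Const 5 0; Const 6 0; Move 3 i; Read 4 3]) (While 4 (Block (foreach_body body))).

Definition for_lists (i k : nat) (body : cmd) : cmd :=
  Seq (Block [:: Const i 1; Const 0 0; Read k 0])
      (While k (Seq body (Block [:: Read 0 i; Add i i 0; Add i i 17;
                                    Defs.Sub k k 17]))).

(** The array of marks starts right after the input: the mark of x is at address [size inp + x]. *)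
Definition memory (inp : seq nat) (f : nat -> nat) (a : nat) : nat :=
  if a < size inp then nth 0 inp a else f (a - size inp).

Lemma memory_mark inp f x : memory inp f (size inp + x) = f x.
Proof. by rewrite /memory ltnNge leq_addr addKn. Qed.

Lemma memory_input inp f a : a < size inp -> memory inp f a = nth 0 inp a.
Proof. by rewrite /memory => ->. Qed.

Lemma upd_memory inp f x v :
  upd (memory inp f) (size inp + x) v = memory inp (upd f x v).
Proof.
apply: functional_extensionality => a; rewrite /upd /memory.
have [->|nax] := eqVneq a (size inp + x); first by rewrite ltnNge leq_addr addKn eqxx.
by case: ltnP => // le; case: eqVneq => // eax; lia.
Qed.

(* The registers below d are unspecified, those from d on contain e. *)
Definition holds inp d e f (s : state) : Prop :=
  [/\ size s.1 = 19, drop d s.1 = e & s.2 = memory inp f].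

Lemma holds_weaken inp d j e f s :
  holds inp d e f s -> holds inp (j + d) (drop j e) f s.
Proof. by case=> sz <- mE; split=> //; rewrite drop_drop. Qed.

(* The list r holds the registers from 7 on, so its entries of index 9 and 10 *)
(* are registers 16 and 17.                                                   *)
Section Foreach.
Variables (inp : seq nat) (pre s post : seq nat) (body : seq instr).
Variables (h g1 g2 : nat -> nat) (r : seq nat) (i : nat).
Hypothesis inpE : inp = pre ++ (size s :: s) ++ post.
Hypothesis uniq_s : uniq s.
Hypothesis ri : nth 0 r i = size pre.
Hypothesis rbase : nth 0 r 9 = size inp.
Hypothesis rone : nth 0 r 10 = 1.
Hypothesis straight_body : all straight body.
Hypothesis bodyP : forall addr v w ptr cnt a b m, exists w',
  foldl exec ([:: addr, v, w, ptr, cnt, a, b & r], m) body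
  = ([:: addr, h v, w', ptr, cnt, a + g1 v, b + g2 v & r], m).

(** As [s] has no repetition, every cell is transformed once. Besides [body], an element costs 8:
    four instructions to fetch its mark, two to store it and decrement, two jumps. *)
Lemma hoare_foreach f :
  hoare (holds inp 7 r f) (foreach i.+4.+3 body)
        (holds inp 5 [:: \sum_(x <- s) g1 (f x), \sum_(x <- s) g2 (f x) & r]
               (fun x => if x \in s then h (f x) else f x))
        (size s * (size body + 8) + 5).
Proof.
pose I ys (st : state) := exists done, s = done ++ ys /\ exists w0 w1 w2,
  st = ([:: w0, w1, w2, size pre + size done, size ys,
         \sum_(x <- done) g1 (f x), \sum_(x <- done) g2 (f x) & r],
        memory inp (fun x => if x \in done then h (f x) else f x)).
move=> st0 st0P; have szr : size r = 12.
  by case: st0P => sz dr _; have := congr1 size dr; rewrite size_drop sz /= => -[].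
move: st0 st0P; rewrite -/(hoare _ _ _ _).
apply: (hoare_conseq (P' := holds inp 7 r f) (Q' := I [::])
          (T' := 4 + (\sum_(x <- s) (size (foreach_body body) + 2) + 1))) => //.
- apply: (@hoare_seq _ (I s)).
  + apply: hoare_block => // -[rg m] [/= sz dr ->].
    move: sz dr; case: rg => [|w0 [|w1 [|w2 [|w3 [|w4 [|w5 [|w6 rg]]]]]]] //= _; rewrite drop0 => ->.
    exists [::]; split=> //; exists w0, w1, w2; rewrite /= ri !big_nil addn0.
    congr (_, _); congr [:: _, _, _, _, _, _, _ & _].
    by rewrite memory_input inpE ?size_cat /= ?addnS ?ltnS ?leq_addr // nth_cat ltnn subnn.
  + apply: hoare_while => [ys st [done [_ [w0 [w1 [w2 ->]]]]] //|y ys].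
    apply: hoare_block => [|st [done [sE [w0 [w1 [w2 ->]]]]]].
      by rewrite !all_cat straight_body.
    rewrite /foreach_body !foldl_cat /= rone rbase.
    have -> : memory inp (fun x => if x \in done then h (f x) else f x) (size pre + size done + 1) = y.
      rewrite memory_input; last first.
        by rewrite inpE sE !size_cat /= size_cat /=; lia.
      rewrite inpE sE nth_cat ifN; last by lia.
      have -> : size pre + size done + 1 - size pre = (size done).+1 by lia.
      by rewrite /= -catA nth_cat ltnn subnn.
    (* [y] has not been visited yet, so its cell still holds [f y]. *)
    have yd : y \notin done.
      by move: uniq_s; rewrite sE cat_uniq /= negb_or => /and3P[_ /andP[]].
    rewrite memory_mark (negPf yd).
    case: (bodyP (size inp + y) (f y) w2 (size pre + size done + 1) (size ys).+1
       (\sum_(x <- done) g1 (f x)) (\sum_(x <- done) g2 (f x))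
       (memory inp (fun x => if x \in done then h (f x) else f x))) => w' ->.
    rewrite /= rone upd_memory.
    exists (rcons done y); rewrite cat_rcons; split=> //.
    exists (size inp + y), (h (f y)), w'.
    rewrite -!cats1 !big_cat !big_seq1 /= size_cat subn1 /= addnA.
    congr (_, memory _ _); apply: functional_extensionality => x.
    by rewrite /upd mem_cat inE orbC; case: eqP => [->|].
- move=> st [done []]; rewrite cats0 => <- [w0 [w1 [w2 ->]]].
  by split; rewrite /= ?szr.
- by rewrite big_const_seq count_predT iter_addn_0 /foreach_body !size_cat /=; nia.
Qed.

End Foreach.

Section ForLists.
Variables (L : seq (seq nat)) (i k : nat) (body : cmd) (T : seq nat -> nat).
(* J p c d describes the states with pointer p and counter c in which the     *)
(* lists d have been treated; it may leave other registers unspecified.       *)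
Variable J : nat -> nat -> seq (seq nat) -> state -> Prop.
Hypothesis J_read : forall p c d e m, J p c d (e, m) ->
  [/\ nth 0 e i = p, nth 0 e k = c, nth 0 e 17 = 1
    & forall a, a < size (encode L) -> m a = nth 0 (encode L) a].
Hypothesis J_pointer : forall p c d e m p',
  J p c d (e, m) -> J p' c d (set_nth 0 e i p', m).
Hypothesis J_counter : forall p c d e m c',
  J p c d (e, m) -> J p c' d (set_nth 0 e k c', m).
Hypothesis J_scratch : forall p c d e m v,
  J p c d (e, m) -> J p c d (set_nth 0 e 0 v, m).
Hypothesis bodyP : forall d S ys, L = d ++ S :: ys ->
  hoare (J (size (encode d)) (size ys).+1 d) body
        (J (size (encode d)) (size ys).+1 (rcons d S)) (T S).

Lemma size_encode_rcons d (S : seq nat) :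
  size (encode (rcons d S)) = (size (encode d) + size S).+1.
Proof. by rewrite /encode map_rcons flatten_rcons /= size_cat /= addnS. Qed.

Lemma encode_cat d (S : seq nat) ys :
  encode (d ++ S :: ys) =
  (size (d ++ S :: ys) :: flatten [seq size s :: s | s <- d]) ++
  (size S :: S) ++ flatten [seq size s :: s | s <- ys].
Proof. by rewrite /encode map_cat flatten_cat. Qed.

(** The encoding of a prefix [d] is as long as the part of [encode L] before the length cell of the
    next list, hence the pointer [size (encode d)]. *)
Lemma hoare_for_lists :
  hoare (fun s => exists p c, J p c [::] s) (for_lists i k body)
        (J (size (encode L)) 0 L) (\sum_(S <- L) (T S + 6) + 4).
Proof.
pose I ys s := exists d, L = d ++ ys /\ J (size (encode d)) (size ys) d s.
apply: (hoare_conseq (P' := fun s => exists p c, J p c [::] s) (Q' := I [::])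
          (T' := 3 + (\sum_(S <- L) (T S + 4 + 2) + 1))) => //; last first.
- by rewrite addnC -addnA leq_add2r; apply: leq_sum => S _; rewrite -addnA.
- by move=> s [d []]; rewrite cats0 => ->.
apply: (@hoare_seq _ (I L)).
  apply: hoare_block => // -[e m] [p [c Js]]; exists [::]; split=> //=.
  move/(J_pointer 1)/(J_scratch 0): Js => Js.
  have [_ _ _ rd] := J_read Js.
  rewrite nth_set_nth /= rd //; exact: J_counter Js.
apply: hoare_while => [ys [e m] [d [_ /J_read []]] //|S ys s [d [LE Js]]].
have := hoare_seq (bodyP LE) _ Js; apply.
apply: (hoare_block (b := [:: _; _; _; _])) => // -[e m] {}Js /=.
exists (rcons d S); rewrite cat_rcons; split=> //.
have [ei _ _ rd] := J_read Js; have -> : m (nth 0 e i) = size S.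
  rewrite ei rd LE encode_cat; last by rewrite size_cat /=; lia.
  by rewrite nth_cat ltnn subnn.
move/(J_scratch (size S)): Js => Js.
have [-> _ _ _] := J_read Js; rewrite [nth 0 _ 0]nth_set_nth /=.
move/(J_pointer (size (encode d) + size S)): Js => Js.
have [-> _ -> _] := J_read Js; rewrite addn1 -size_encode_rcons.
move/(J_pointer (size (encode (rcons d S)))): Js => Js.
have [_ -> -> _] := J_read Js; rewrite subn1 /=; exact: J_counter Js.
Qed.

End ForLists.

(** Names the highest unspecified register, so that rules listing more registers apply. *)
Lemma hoare_expose inp d e f c Q T :
  d < 19 -> (forall x, hoare (holds inp d (x :: e) f) c Q T) ->
  hoare (holds inp d.+1 e f) c Q T.
Proof.
move=> lt H s [sz eE mE]; apply: (H (nth 0 s.1 d)); split=> //.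
by rewrite (drop_nth 0) ?sz // eE.
Qed.

Lemma hoare_ext inp P c d e f f' T :
  f =1 f' -> hoare P c (holds inp d e f) T -> hoare P c (holds inp d e f') T.
Proof. by move=> /functional_extensionality ->. Qed.

(* Splits the register list rg into 19 variables, substituting the known ones. *)
Ltac explicit rg :=
  let sz := fresh in let dr := fresh in let mE := fresh in
  case=> /= sz dr mE; rewrite ?mE {mE}; move: sz dr;
  do 19 (case: rg => [|? rg] //); case: rg => // _ /= [];
  repeat match goal with |- _ = _ -> _ =>
    let h := fresh in move=> h; rewrite ?h {h}
  end.

(** On marks 0 and 1 this is v + 3(1 - v): elements of P keep 1, those of Q \ P get 3 and are
    counted in register 5. *)
Definition mark_steps : seq instr :=
  [:: Defs.Sub 2 17 1; Add 5 5 2; Add 1 1 2; Add 1 1 2; Add 1 1 2].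
(** Register 5 counts the marks at least 2, register 6 the marks 0. *)
Definition scan_steps : seq instr :=
  [:: Defs.Sub 2 17 1; Add 6 6 2; Defs.Sub 2 18 1; Defs.Sub 2 17 2; Add 5 5 2].
(** The flag in register 7 is negated: 0 means that S qualifies. *)
Definition flag_steps : seq instr :=
  [:: Defs.Sub 2 8 5; Defs.Sub 2 17 2; Defs.Sub 1 17 6; Defs.Sub 1 1 2;
      Defs.Sub 7 17 1].
(** A mark 3 drops to 2 if the flag is 0; marks up to 2 never change. *)
Definition cover_steps : seq instr :=
  [:: Defs.Sub 2 1 18; Defs.Sub 2 2 7; Defs.Sub 1 1 2].
(** Counts the marks 3 and sends 1, 2, 3 to 1, 0, 0, leaving only the marks of P. *)
Definition tally_steps : seq instr :=
  [:: Defs.Sub 2 1 18; Add 5 5 2; Defs.Sub 1 18 1].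

Definition count_uncovered : cmd :=
  Seq (foreach 13 mark_steps)
 (Seq (Block [:: Move 8 5])
 (Seq (for_lists 9 10 (Seq (foreach 9 scan_steps)
                      (Seq (Block flag_steps) (foreach 9 cover_steps))))
 (Seq (foreach 13 tally_steps)
      (Block [:: Move 7 5])))).

(** * Counting the uncovered elements for one pair *)

Section CountUncovered.
Implicit Types P Q S : seq nat.
Implicit Types D L : seq (seq nat).

Definition fresh P Q : nat := count (fun x => x \notin P) Q.

(** For repetition-free lists: S \ P is a proper subset of Q \ P, expressed as inclusion and smaller
    cardinality, which one scan of S can decide. *)
Definition qualifies P Q S : bool :=
  all (fun x => (x \in P) || (x \in Q)) S && (fresh P S < fresh P Q).

Definition covers P Q D x : bool :=
  has (fun S => qualifies P Q S && (x \in S)) D.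

Definition uncovered P Q D : nat :=
  count (fun x => (x \notin P) && ~~ covers P Q D x) Q.

(* The contents of the cell of x after the lists D have been examined: 0      *)
(* outside P u Q, 1 in P, 2 or 3 in Q \ P according as x is covered or not.   *)
(* With these values all tests reduce to truncated subtractions.              *)
Definition mark P Q D x : nat :=
  if x \in P then 1 else if x \in Q then 3 - covers P Q D x else 0.

Definition indicator P x : nat := x \in P.

Lemma sum_count (I : Type) (r : seq I) (F : I -> nat) (a : pred I) :
  (forall x, F x = a x) -> \sum_(x <- r) F x = count a r.
Proof.
move=> FE; rewrite -sum1_count [RHS]big_mkcond /=.
by apply: eq_bigr => x _; rewrite FE; case: (a x).
Qed.

(** The left side is what [flag_steps] computes. If [o] is 0, all elements of [S] outside [P] lie in
    [Q], so [k] is [fresh P S]. *)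
Lemma qualifiesE P Q S :
  let o := count (fun x => (x \notin P) && (x \notin Q)) S in
  let k := count (fun x => (x \notin P) && (x \in Q)) S in
  1 - ((1 - o) - (1 - (fresh P Q - k))) = ~~ qualifies P Q S.
Proof.
move=> o k; rewrite /qualifies.
have -> : all (fun x => (x \in P) || (x \in Q)) S = (o == 0).
  rewrite -leqn0 leqNgt -has_count -all_predC; apply: eq_all => x /=.
  by rewrite -negb_or negbK.
have [o0|/= on0] := eqVneq o 0; last by lia.
have -> : fresh P S = k; last by case: ltnP => /=; lia.
apply: eq_in_count => x xS; have : ~~ has (fun x => (x \notin P) && (x \notin Q)) S.
  by rewrite has_count -/o o0.
by move/hasPn/(_ x xS); case: (x \in P); case: (x \in Q).
Qed.

Variables (L D1 D2 : seq (seq nat)) (P Q : seq nat) (pp pc qc fail : nat).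
Hypothesis LE : L = D1 ++ Q :: D2.
Hypothesis uniqL : all uniq L.
Let R := [:: pp; pc; size (encode D1); qc; fail; size (encode L); 1; 2].

Lemma uniq_Q : uniq Q.
Proof. by move: uniqL; rewrite LE all_cat => /andP[_ /= /andP[]]. Qed.

Lemma hoare_cover_list D S D' (c0 : nat) : L = D ++ S :: D' ->
  let e p c : seq nat := [:: fresh P Q, p, c & R] in
  hoare (holds (encode L) 8 (e (size (encode D)) c0) (mark P Q D))
        (Seq (foreach 9 scan_steps) (Seq (Block flag_steps) (foreach 9 cover_steps)))
        (holds (encode L) 8 (e (size (encode D)) c0) (mark P Q (rcons D S)))
        (24 * size S + 15).
Proof.
move=> LS e.
have uS : uniq S by move: uniqL; rewrite LS all_cat => /andP[_ /= /andP[]].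
have inpE := encode_cat D S D'; rewrite -LS in inpE.
apply: hoare_expose => // nf.
pose o := count (fun x => (x \notin P) && (x \notin Q)) S.
pose k := count (fun x => (x \notin P) && (x \in Q)) S.
apply: hoare_cost; first apply: (hoare_seq (R := holds (encode L) 5
  [:: k, o, nf & e (size (encode D)) c0] (mark P Q D))).
- have := @hoare_foreach _ _ _ _ scan_steps id (fun v => 1 - (2 - v)) (fun v => 1 - v)
    (nf :: e (size (encode D)) c0) 2 inpE uS erefl erefl erefl erefl.
  move=> /(_ _ (mark P Q D)); rewrite (sum_count _ (a := fun x => (x \notin P) && (x \in Q))).
    rewrite (sum_count _ (a := fun x => (x \notin P) && (x \notin Q))).
    move=> H; apply: hoare_ext; last apply: H.
      by move=> x; rewrite if_same.
    by move=> *; eexists; reflexivity.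
  + by move=> x; rewrite /mark; case: (x \in P); case: (x \in Q); case: covers.
  + by move=> x; rewrite /mark; case: (x \in P); case: (x \in Q); case: covers.
- apply: (hoare_seq (R := holds (encode L) 7
     [:: nat_of_bool (~~ qualifies P Q S) & e (size (encode D)) c0] (mark P Q D))).
    apply: hoare_block => // -[rg m]; explicit rg; split=> //=.
    by rewrite -qualifiesE.
  have := @hoare_foreach _ _ _ _ cover_steps (fun v => v - ((v - 2) - ~~ qualifies P Q S))
    (fun=> 0) (fun=> 0)
    (nat_of_bool (~~ qualifies P Q S) :: e (size (encode D)) c0) 2 inpE uS erefl erefl erefl erefl.
  move=> /(_ _ (mark P Q D)) H; apply: hoare_conseq (H _) _ _ (leqnn _) => //.
    by move=> *; eexists; rewrite !addn0; reflexivity.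
  move=> s /(@holds_weaken _ 5 3); congr holds; apply: functional_extensionality => x.
  rewrite /mark /covers has_rcons orbC; set b := has _ D.
  by case: (x \in P); case: (x \in Q); case: (x \in S); case: (qualifies P Q S); case: b.
- by rewrite /=; lia.
Qed.

Lemma hoare_count_uncovered :
  hoare (holds (encode L) 11 R (indicator P)) count_uncovered
        (holds (encode L) 7
           [:: uncovered P Q L, fresh P Q, size (encode L), 0 & R] (indicator P))
        (24 * size Q + \sum_(S <- L) (24 * size S + 21) + 16).
Proof.
have inpE := encode_cat D1 Q D2; rewrite -LE in inpE.
apply: hoare_expose => // sc; apply: hoare_expose => // sp.
apply: hoare_expose => // q; apply: hoare_expose => // nf.
apply: hoare_cost; first apply: (hoare_seq (R := holds (encode L) 5
  [:: fresh P Q, 0, nf, q, sp, sc & R] (mark P Q [::]))).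
- have := @hoare_foreach _ _ _ _ mark_steps (fun v => v + (1 - v) + (1 - v) + (1 - v))
    (fun v => 1 - v) (fun=> 0) ([:: nf, q, sp, sc & R]) 6 inpE uniq_Q erefl erefl erefl erefl.
  move=> /(_ _ (indicator P)) H; apply: hoare_conseq (H _) _ _ (leqnn _) => //.
    by move=> *; eexists; rewrite !addn0; reflexivity.
  move=> s; rewrite (sum_count _ (a := fun x => x \notin P)); last first.
    by move=> x; rewrite /indicator; case: (x \in P).
  rewrite big1 //; congr holds; apply: functional_extensionality => x.
  by rewrite /mark /indicator; case: (x \in P); case: (x \in Q).
- apply: (hoare_seq (R := fun s => exists p c, holds (encode L) 8
     [:: fresh P Q, p, c & R] (mark P Q [::]) s)).
    by apply: hoare_block => // -[rg m]; explicit rg; exists sp, sc.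
  apply: hoare_seq.
    apply: (hoare_for_lists (L := L) (J := fun p c D => holds (encode L) 8
     [:: fresh P Q, p, c & R] (mark P Q D))).
    + move=> p c D e m; explicit e; split=> // a; exact: (@memory_input (encode L)).
    + by move=> p c D e m p'; explicit e.
    + by move=> p c D e m p'; explicit e.
    + by move=> p c D e m p'; explicit e.
    + move=> d S ys LS; apply: hoare_cover_list LS.
  apply: hoare_expose => // nf'.
  apply: (hoare_seq (R := holds (encode L) 5 [:: uncovered P Q L, 0, nf',
      fresh P Q, size (encode L), 0 & R] (indicator P))); last first.
    by apply: hoare_block => // -[rg m]; explicit rg.
  have := @hoare_foreach _ _ _ _ tally_steps (fun v => 2 - v) (fun v => v - 2) (fun=> 0)
    ([:: nf', fresh P Q, size (encode L), 0 & R]) 6 inpE uniq_Q erefl erefl erefl erefl.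
  move=> /(_ _ (mark P Q L)) H; apply: hoare_conseq (H _) _ _ (leqnn _) => //.
    by move=> *; eexists; rewrite !addn0; reflexivity.
  move=> s; rewrite (sum_count _ (a := fun x => [&& x \in Q, x \notin P & ~~ covers P Q L x])).
    rewrite big1 // (eq_in_count (a2 := fun x => (x \notin P) && ~~ covers P Q L x)).
      congr holds; apply: functional_extensionality => x; rewrite /mark /indicator.
      by case: (x \in P); case: (x \in Q); case: covers.
    by move=> x /= ->.
  by move=> x; rewrite /mark; case: (x \in P); case: (x \in Q); case: covers.
- rewrite (eq_bigr (fun S => 24 * size S + 21)) /=; first by lia.
  by move=> S _; rewrite -addnA.
Qed.

End CountUncovered.

(** Only the cells of P are cleared at the end, so the cost does not depend on the size of the
    integers. *)
Definition check_pair : cmd :=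
  Seq (foreach 11 [:: Const 1 1])
 (Seq count_uncovered
 (Seq (Block [:: Defs.Sub 1 7 17; Add 15 15 1])
      (foreach 11 [:: Const 1 0]))).

(** No mark is set at the first count, so it concerns the empty P, and register 8 then holds |Q|. *)
Definition check_list : cmd :=
  Seq count_uncovered
 (Seq (Block [:: Defs.Sub 1 17 8; Defs.Sub 1 17 1; Defs.Sub 1 1 7; Add 15 15 1])
      (for_lists 11 12 check_pair)).

(* The first, empty loop leaves in register 13 the first address after the    *)
(* input, where the marks are stored.                                         *)
Definition base_test : cmd :=
  Seq (Block [:: Const 17 1; Const 18 2])
 (Seq (for_lists 13 14 (Block [::]))
 (Seq (Block [:: Move 16 13])
 (Seq (for_lists 13 14 check_list)
      (Block [:: Defs.Sub 0 17 15])))).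

(** * Counting the failures of a family *)

Section BaseTest.
Variable L : seq (seq nat).
Hypothesis uniqL : all uniq L.

(** Positive exactly when two elements of Q \ P are uncovered, which violates [accessible]. *)
Definition pair_failures (P Q : seq nat) : nat := uncovered P Q L - 1.

(* 1 - (1 - size Q) is 0 if Q is empty and 1 otherwise: the difference is     *)
(* positive iff Q is the union of its proper subsets in the family.           *)
Definition list_failures (Q : seq nat) : nat :=
  1 - (1 - size Q) - uncovered [::] Q L + \sum_(P <- L) pair_failures P Q.

Lemma fresh_nil Q : fresh [::] Q = size Q.
Proof. by rewrite /fresh (eq_count (a2 := predT)) ?count_predT. Qed.

Let K := \sum_(S <- L) (24 * size S + 21).

Lemma hoare_check_pair D1 Q D2 D P D' pc qc fail :
  L = D1 ++ Q :: D2 -> L = D ++ P :: D' ->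
  let e fail := [:: size (encode D); pc; size (encode D1); qc; fail; size (encode L); 1; 2] in
  hoare (holds (encode L) 11 (e fail) (indicator [::])) check_pair
        (holds (encode L) 11 (e (fail + pair_failures P Q)) (indicator [::]))
        (18 * size P + 24 * size Q + K + 28).
Proof.
move=> LQ LP e.
have uP : uniq P by move: uniqL; rewrite LP all_cat => /andP[_ /= /andP[]].
have inpE := encode_cat D P D'; rewrite -LP in inpE.
apply: hoare_cost; first apply: (hoare_seq (R := holds (encode L) 11 (e fail) (indicator P))).
- apply: hoare_expose => // sc; apply: hoare_expose => // sp.
  apply: hoare_expose => // q; apply: hoare_expose => // nf.
  have := @hoare_foreach _ _ _ _ [:: Const 1 1] (fun=> 1) (fun=> 0) (fun=> 0)
    ([:: nf, q, sp, sc & e fail]) 4 inpE uP erefl erefl erefl erefl.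
  move=> /(_ _ (indicator [::])) H; apply: hoare_conseq (H _) _ _ (leqnn _) => //.
    by move=> *; eexists; rewrite !addn0; reflexivity.
  exact: (@holds_weaken _ 5 6).
- apply: hoare_seq; first exact: hoare_count_uncovered LQ uniqL.
  apply: (hoare_seq (R := holds (encode L) 11 (e (fail + pair_failures P Q)) (indicator P))).
    by apply: hoare_block => // -[rg m]; explicit rg.
  apply: hoare_expose => // sc; apply: hoare_expose => // sp.
  apply: hoare_expose => // q; apply: hoare_expose => // nf.
  have := @hoare_foreach _ _ _ _ [:: Const 1 0] (fun=> 0) (fun=> 0) (fun=> 0)
    ([:: nf, q, sp, sc & e (fail + pair_failures P Q)]) 4 inpE uP erefl erefl erefl erefl.
  move=> /(_ _ (indicator P)) H; apply: hoare_conseq (H _) _ _ (leqnn _) => //.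
    by move=> *; eexists; rewrite !addn0; reflexivity.
  move=> s /(@holds_weaken _ 5 6); congr holds; apply: functional_extensionality => x.
  by rewrite /indicator; case: (x \in P).
- by rewrite /K /=; lia.
Qed.

Lemma hoare_check_list D1 Q D2 qc fail :
  L = D1 ++ Q :: D2 ->
  let e fail := [:: size (encode D1); qc; fail; size (encode L); 1; 2] in
  hoare (holds (encode L) 13 (e fail) (indicator [::])) check_list
        (holds (encode L) 13 (e (fail + list_failures Q)) (indicator [::]))
        (24 * size Q + K + \sum_(P <- L) (18 * size P + 24 * size Q + K + 34) + 24).
Proof.
move=> LQ e; apply: hoare_expose => // pc; apply: hoare_expose => // pp.
apply: hoare_cost.
  apply: hoare_seq; first exact: hoare_count_uncovered LQ uniqL.
  rewrite fresh_nil.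
  pose fail0 := fail + (1 - (1 - size Q) - uncovered [::] Q L).
  apply: (hoare_seq (R := fun s => exists p c, holds (encode L) 11
     [:: p, c & e fail0] (indicator [::]) s)).
    by apply: hoare_block => // -[rg m]; explicit rg; exists pp, pc.
  have -> : fail + list_failures Q = fail0 + \sum_(P <- L) pair_failures P Q.
    by rewrite /fail0 -addnA.
  apply: hoare_conseq.
  - apply: (hoare_for_lists (L := L) (J := fun p c D => holds (encode L) 11
       [:: p, c & e (fail0 + \sum_(P <- D) pair_failures P Q)] (indicator [::]))).
    + move=> p c D rg m; explicit rg; split=> // a; exact: (@memory_input (encode L)).
    + by move=> p c D rg m v; explicit rg.
    + by move=> p c D rg m v; explicit rg.
    + by move=> p c D rg m v; explicit rg.
    + move=> D P D' LP; rewrite -cats1 big_cat big_seq1 /= addnA; apply: hoare_check_pair LQ LP.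
  - by move=> s [p [c]] H; exists p, c; rewrite big_nil addn0.
  - by move=> s /(@holds_weaken _ 11 2).
  - exact: leqnn.
have -> : \sum_(P <- L) (18 * size P + 24 * size Q + K + 28 + 6)
        = \sum_(P <- L) (18 * size P + 24 * size Q + K + 34).
  by apply: eq_bigr => P _; rewrite -addnA.
by rewrite -/K /=; lia.
Qed.

Definition failures : nat := \sum_(Q <- L) list_failures Q.

Lemma hoare_base_test :
  hoare (fun s => s = ([::], memory (encode L) (fun=> 0))) base_test
        (fun s => nth 0 s.1 0 = (failures == 0))
        (\sum_(Q <- L) (24 * size Q + K + \sum_(P <- L) (18 * size P + 24 * size Q + K + 34) + 36) + 12).
Proof.
apply: hoare_cost.
apply: (hoare_seq (R := holds (encode L) 13 [:: 0; 0; 0; 0; 1; 2] (indicator [::]))).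
  (* Writing registers 17 and 18 stretches the empty register list to its length 19, padded with
     zeros. *)
  by apply: hoare_block => // s ->.
apply: (hoare_seq (R := holds (encode L) 13 [:: size (encode L); 0; 0; 0; 1; 2] (indicator [::]))).
  apply: hoare_conseq.
  - apply: (hoare_for_lists (L := L) (T := fun=> 0) (J := fun p c D => holds (encode L) 13
       [:: p; c; 0; 0; 1; 2] (indicator [::]))).
    + move=> p c D rg m; explicit rg; split=> // a; exact: (@memory_input (encode L)).
    + by move=> p c D rg m v; explicit rg.
    + by move=> p c D rg m v; explicit rg.
    + by move=> p c D rg m v; explicit rg.
    + by move=> D P D' LP; apply: (hoare_block (b := [::])).
  - by move=> s H; exists 0, 0.
  - by move=> s; apply.
  - exact: leqnn.
pose e p c fail := [:: p; c; fail; size (encode L); 1; 2].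
apply: (hoare_seq (R := holds (encode L) 13 (e (size (encode L)) 0 0) (indicator [::]))).
  by apply: hoare_block => // -[rg m]; explicit rg.
apply: (hoare_seq (R := holds (encode L) 13 (e (size (encode L)) 0 failures) (indicator [::]))).
  apply: hoare_conseq.
  - apply: (hoare_for_lists (L := L) (J := fun p c D => holds (encode L) 13
       (e p c (\sum_(Q <- D) list_failures Q)) (indicator [::]))).
    + move=> p c D rg m; explicit rg; split=> // a; exact: (@memory_input (encode L)).
    + by move=> p c D rg m v; explicit rg.
    + by move=> p c D rg m v; explicit rg.
    + by move=> p c D rg m v; explicit rg.
    + move=> D Q D' LQ; rewrite -cats1 big_cat big_seq1 /=; apply: hoare_check_list LQ.
  - by move=> s H; exists (size (encode L)), 0; rewrite big_nil.
  - by move=> s; apply.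
  - exact: leqnn.
apply: hoare_block => // -[rg m]; explicit rg.
by case: failures.
pose A (Q : seq nat) := 24 * size Q + K + \sum_(P <- L) (18 * size P + 24 * size Q + K + 34).
have -> : \sum_(Q <- L) (A Q + 36) = \sum_(Q <- L) (0 + 6) + \sum_(Q <- L) (A Q + 24 + 6).
  by rewrite -big_split; apply: eq_bigr => Q _ /=; lia.
by rewrite /A /=; lia.
Qed.

Lemma sum_linear (T : Type) (r : seq T) (F : T -> nat) a b :
  \sum_(x <- r) (a * F x + b) = a * \sum_(x <- r) F x + b * size r.
Proof. by rewrite big_split -big_distrr big_const_seq count_predT iter_addn_0. Qed.

(** The term n^3 is at most n^2 * m + n^2. For m > 0 every other monomial is at most n^2 * m; for m
    = 0 at most one list remains, and the summand 1 pays for it. *)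
Lemma base_test_cost :
  let n := size L in let m := \sum_(S <- L) size S in n <= m + 1 ->
  \sum_(Q <- L) (24 * size Q + K + \sum_(P <- L) (18 * size P + 24 * size Q + K + 34) + 36)
    + 12 <= 400 * (n ^ 2 * m + 1).
Proof.
move=> n m nm.
have [/size0nil L0|ngt0] := posnP n; first by rewrite {1}L0 big_nil mulnDr; apply: leq_trans (leq_addl _ _).
have EK : K = 24 * m + 21 * n by apply: sum_linear.
rewrite (eq_bigr (fun Q => (24 + 24 * n) * size Q + (K + 18 * m + (K + 34) * n + 36))).
  rewrite sum_linear -/n -/m EK; clearbody n m; clear EK.
  have [m0|mgt0] := posnP m.
    by rewrite m0 in nm *; case: n nm ngt0 => [|[|]] //; lia.
  have h2 : n ^ 2 <= n ^ 2 * m by rewrite leq_pmulr.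
  have h3 : n <= n ^ 2 by rewrite -mulnn leq_pmulr.
  have h1 : n * m <= n ^ 2 * m by rewrite leq_mul.
  have h4 : m <= n ^ 2 * m by rewrite leq_pmull // expn_gt0 ngt0.
  have h5 : n ^ 2 * n <= n ^ 2 * m + n ^ 2 by rewrite addnC -mulnS leq_mul2l -(addn1 m) nm orbT.
  move: h1 h2 h3 h4 h5; rewrite -mulnn; set p := n * n; set q := p * m; set r := p * n.
  have -> : (24 + 24 * n) * m + (24 * m + 21 * n + 18 * m + (24 * m + 21 * n + 34) * n + 36) * n
     = 24 * m + 66 * (n * m) + 55 * p + 36 * n + 24 * q + 21 * r by rewrite /q /r /p; ring.
  lia.
move=> Q _; rewrite (eq_bigr (fun P => 18 * size P + (24 * size Q + K + 34))).
  by rewrite sum_linear -/n -/m; lia.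
by move=> P _; rewrite !addnA.
Qed.

Lemma base_test_outputs :
  size L <= \sum_(S <- L) size S + 1 ->
  outputs_within (code 0 base_test) (encode L)
    (400 * (size L ^ 2 * \sum_(S <- L) size S + 1)) (failures == 0).
Proof.
move=> nm; have := hoare_base_test; case/(_ _ erefl) => s' [t [rn lt out]].
have {}lt := leq_trans lt (base_test_cost nm).
have {}rn : iter t (step (code 0 base_test ++ [::]))
    (conf 0 ([::], memory (encode L) (fun=> 0)))
  = conf (size (code 0 base_test)) s' by exact: rn [::] [::].
rewrite cats0 in rn.
have init : initial (encode L) = conf 0 ([::], memory (encode L) (fun=> 0)).
  rewrite /initial /conf; congr Config.
  - by apply: functional_extensionality => x; rewrite nth_nil.
  - apply: functional_extensionality => x; rewrite /= /memory.
    by case: (ltnP x (size (encode L))) => // le; apply: nth_default.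
rewrite /outputs_within init -(subnK lt) iterD rn.
set c := conf _ s'; have fc : fetch (code 0 base_test) c = Halt.
  by rewrite /fetch nth_default.
(* A halted configuration is a fixed point, so running up to the full time bound is harmless. *)
have stop u : iter u (step (code 0 base_test)) c = c.
  by elim: u => //= u ->; rewrite {1}/step {1}/c /conf fc.
by rewrite stop /halted fc.
Qed.

End BaseTest.

(** * From lists to sets *)

Section Lists.
Local Open Scope fset_scope.
Local Open Scope nat_scope.

Lemma count_le1P (T : eqType) (a : pred T) (s : seq T) : uniq s ->
  reflect {in s &, forall x y, a x -> a y -> x = y} (count a s <= 1).
Proof.
move=> us; rewrite -size_filter; apply: (iffP idP) => [le x y xs ys ax ay|H].
  have : x \in filter a s by rewrite mem_filter ax.
  have : y \in filter a s by rewrite mem_filter ay.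
  by case: filter le => [|z [|]] //= _; rewrite !inE => /eqP -> /eqP ->.
case E: (filter a s) (filter_uniq a us) => [|x [|y f]] //=.
have mE z : z \in [:: x, y & f] -> a z /\ z \in s by rewrite -E mem_filter => /andP.
rewrite inE => /andP[/norP[/eqP[]]].
have [|ax xs] := mE x; first by rewrite inE eqxx.
by have [|ay ys] := mE y; [rewrite !inE eqxx orbT | apply: H].
Qed.

Lemma card_fseqD (P S : seq nat) : uniq S ->
  #|` [fset x in S] `\` [fset x in P]| = fresh P S.
Proof.
move=> uS; have -> : [fset x in S] `\` [fset x in P] = [fset x in [seq x <- S | x \notin P]].
  by apply/fsetP => x; rewrite !inE mem_filter.
by rewrite card_fseq undup_id ?filter_uniq // size_filter.
Qed.

Lemma qualifiesP (P Q S : seq nat) : uniq Q -> uniq S ->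
  qualifies P Q S =
  (([fset x in S] `\` [fset x in P]) `<` ([fset x in Q] `\` [fset x in P])).
Proof.
move=> uQ uS; rewrite fproperEcard !card_fseqD // /qualifies; congr (_ && _).
apply/allP/fsubsetP => H x.
  by rewrite !inE => /andP[xP /H]; rewrite (negPf xP).
by move=> xS; have := H x; rewrite !inE xS; case: (x \in P) => //= ->.
Qed.

Variables (L : seq (seq nat)) (B : {fset {fset nat}}).
Hypothesis LB : lists_family L B.

Let uniqL : all uniq L. Proof. by case: LB. Qed.

Lemma mem_listed S : reflect (exists2 s, s \in L & S = [fset x in s]) (S \in B).
Proof. by case: LB => _ /perm_mem <-; apply: (iffP mapP). Qed.

Lemma coversP P Q x : Q \in L ->
  reflect (covered B [fset x in P] [fset x in Q] x) (covers P Q L x).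
Proof.
move=> QL; have uQ := allP uniqL _ QL.
apply: (iffP hasP) => [[S SL /andP[q xS]]|[_ [/mem_listed [S SL ->]]]].
  exists [fset x in S]; split; first by apply/mem_listed; exists S.
    by rewrite inE.
  by rewrite -qualifiesP // (allP uniqL).
rewrite inE => xS q; exists S; rewrite // xS andbT qualifiesP //.
exact: allP uniqL _ SL.
Qed.

Lemma fset_nil : [fset x in [::]] = fset0 :> {fset nat}.
Proof. by apply/fsetP => x; rewrite !inE. Qed.

(** A sum of naturals vanishes iff all summands do; the first summand of [list_failures] tests
    irredundancy at Q, the others accessibility for the pairs (P, Q). *)
Lemma failures_eq0 : failures L == 0 <-> irredundant B /\ accessible B.
Proof.
have -> : (failures L == 0) = all (fun Q => list_failures L Q == 0) L.
  by rewrite /failures sum_nat_seq_eq0.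
have listE Q : (list_failures L Q == 0) =
   ((Q == [::]) || (0 < uncovered [::] Q L)) && all (fun P => uncovered P Q L <= 1) L.
  rewrite /list_failures addn_eq0 sum_nat_seq_eq0; congr (_ && _).
  by case: Q => [|x Q] //=; lia.
rewrite (eq_all listE).
split=> [/allP H|[irr acc]].
  split=> [_ /mem_listed [Q QL ->] Qn0|].
    have /andP[/orP[/eqP Q0|]] := H Q QL; first by rewrite Q0 fset_nil eqxx in Qn0.
    rewrite -has_count => /hasP[x xQ /= ncov] _.
    exists x; first by rewrite inE.
    by rewrite -fset_nil => /(coversP _ _ QL); apply/negP.
  move=> _ _ x y /mem_listed [P PL ->] /mem_listed [Q QL ->].
  rewrite !inE => /andP[xP xQ] /andP[yP yQ] nxy.
  have /andP[_ /allP/(_ P PL)] := H Q QL.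
  move/(count_le1P _ (allP uniqL _ QL))/(_ x y xQ yQ); rewrite xP yP /=.
  case cx: (covers P Q L x); first by left; apply/coversP.
  case cy: (covers P Q L y); first by right; apply/coversP.
  by move=> /(_ isT isT) e; rewrite e eqxx in nxy.
apply/allP => Q QL; have QB : [fset x in Q] \in B by apply/mem_listed; exists Q.
apply/andP; split.
  have [//|Qn0 /=] := eqVneq Q [::].
  case: (irr _ QB) => [|x]; last first.
    rewrite inE => xQ ncov; rewrite -has_count; apply/hasP; exists x => //=.
    by apply/(coversP _ _ QL); rewrite fset_nil.
  by case: Q Qn0 {QL QB} => // x Q _; apply/fset0Pn; exists x; rewrite !inE eqxx.
apply/allP => P PL; have PB : [fset x in P] \in B by apply/mem_listed; exists P.
apply/count_le1P => [|x y xQ yQ /andP[xP cx] /andP[yP cy]]; first exact: allP uniqL _ QL.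
apply/eqP; apply: contraT => nxy.
by case: (acc _ _ x y PB QB) => //; rewrite ?inE ?xP ?yP // => /(coversP _ _ QL);
  [rewrite (negPf cx)|rewrite (negPf cy)].
Qed.

Lemma size_listed : size L = #|` B|.
Proof. by case: LB => _ /perm_size; rewrite size_map. Qed.

Lemma sum_size_listed : \sum_(S <- L) size S = \sum_(S <- B) #|` S|.
Proof.
case: LB => _ /(perm_big _) <-; rewrite big_map /=; apply: eq_big_seq => S SL.
by rewrite card_fseq undup_id // (allP uniqL).
Qed.

(** Every nonempty list contributes at least 1, and the empty list occurs at most once. *)
Lemma size_le_sum : size L <= \sum_(S <- L) size S + 1.
Proof.
have uL : uniq L.
  case: LB => _ /perm_uniq uE; have : uniq (enum_fset B) by apply: fset_uniq.
  by rewrite -uE => /map_uniq.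
have : count (pred1 [::]) L <= 1.
  by apply/(count_le1P _ uL) => x y _ _ /eqP -> /eqP ->.
have : size L <= \sum_(S <- L) size S + count (pred1 [::]) L; last by lia.
elim: L => [|S L' IH]; rewrite ?big_nil // big_cons /=.
move: IH; set c := count _ _; set k := \sum_(_ <- _) _.
by case: S => [|x S] /=; lia.
Qed.

End Lists.

Theorem theorem23 :
  exists (p : program) (C : nat),
    forall (B : {fset {fset nat}}) (L : seq (seq nat)),
      lists_family L B ->
      let n := #|` B|%fset in
      let m := \sum_(S <- B) #|` S|%fset in
      exists b : bool,
        outputs_within p (encode L) (C * (n ^ 2 * m + 1)) b /\
        (b <-> exists F : {fset {fset nat}},
                 [/\ union_closed F, well_graded F & is_base B F]).
Proof.
exists (code 0 base_test), 400 => B L LB n m; exists (failures L == 0).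
split; last first.
  by split=> [/(failures_eq0 LB)/base_well_gradedP|/base_well_gradedP/(failures_eq0 LB)].
rewrite /n /m -(size_listed LB) -(sum_size_listed LB).
by apply: base_test_outputs; [case: LB | apply: size_le_sum LB].
Qed.
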